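(* Let $P_1,P_2,P_3$ be the constants $$P_1=2\|x_1-x_\star\|^2+4\|\mathbf{1}+z_\star\|^2,\quad P_2=8(4C_F^2+\sigma_F^2)+2\|D_G\|^2,\quad P_3=8m(4\|C_G\|^2+\|\sigma_G\|^2),$$ with $P_3>0$. For any $\varepsilon>0$, the optimal solution $(K_\star,\gamma_\star)$ of the problem of minimizing $K$ over real $K>0$ and $\gamma>0$ subject to $$\frac{P_1+P_2\gamma^2}{4\gamma\sqrt{K}(1-P_3\gamma^2)}\le\varepsilon,\qquad P_3\gamma^2<1,$$ satisfies $$\gamma_\star^2=\frac{2P_3^{-1}}{2+y+\sqrt{y^2+8y}},\qquad K_\star=\frac{(P_1+P_2\gamma_\star^2)^2}{16\gamma_\star^2(1-P_3\gamma_\star^2)^2\varepsilon^2},$$ where $y=1+\dfrac{P_2}{P_1P_3}$.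
   Context: Here $m\ge1$; $x_1,x_\star\in\mathbb{R}^n$ (initial point and primal optimizer), $z_\star\in\mathbb{R}^m_+$ (dual optimizer); $C_F,\sigma_F\ge0$ are real numbers and $C_G,D_G,\sigma_G$ are vectors in $\mathbb{R}^m$ with nonnegative entries (bounds on subgradients, second moments and standard deviations of problem data). $\|\cdot\|$ is the Euclidean norm and $\mathbf{1}\in\mathbb{R}^m$ the all-ones vector. $K$ is an iteration count whose integrality is ignored, so it ranges over positive reals. *)

(* Defs.v *)
From mathcomp Require Import all_boot all_order all_algebra.
From mathcomp Require Import reals.

Set Implicit Arguments.
Unset Strict Implicit.
Unset Printing Implicit Defensive.

Import Order.TTheory GRing.Theory Num.Theory.
Local Open Scope ring_scope.

(* Euclidean norm; MathComp-Analysis equips matrices with the sup norm. *)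
Definition norm2 (R : realType) (n : nat) (v : 'cV[R]_n) : R :=
  Num.sqrt (\sum_(i < n) v i 0 ^+ 2).

Definition nonneg_vec (R : realType) (n : nat) (v : 'cV[R]_n) : Prop :=
  forall i : 'I_n, 0 <= v i 0.

Definition P1 (R : realType) (n m : nat) (x1 xstar : 'cV[R]_n)
    (zstar : 'cV[R]_m) : R :=
  2 * norm2 (x1 - xstar) ^+ 2 + 4 * norm2 (const_mx 1 + zstar) ^+ 2.

Definition P2 (R : realType) (m : nat) (CF sigmaF : R) (DG : 'cV[R]_m) : R :=
  8 * (4 * CF ^+ 2 + sigmaF ^+ 2) + 2 * norm2 DG ^+ 2.

Definition P3 (R : realType) (m : nat) (CG sigmaG : 'cV[R]_m) : R :=
  8 * m%:R * (4 * norm2 CG ^+ 2 + norm2 sigmaG ^+ 2).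

Definition feasible (R : realType) (p1 p2 p3 eps K gamma : R) : Prop :=
  [/\ 0 < K, 0 < gamma,
      (p1 + p2 * gamma ^+ 2)
        / (4 * gamma * Num.sqrt K * (1 - p3 * gamma ^+ 2)) <= eps
    & p3 * gamma ^+ 2 < 1].

Definition optimal_solution (R : realType) (p1 p2 p3 eps K gamma : R) : Prop :=
  feasible p1 p2 p3 eps K gamma /\
  forall K' gamma' : R, feasible p1 p2 p3 eps K' gamma' -> K <= K'.

(* Main.v *)
(* Only gamma |-> f(gamma) = (p1 + p2 gamma^2) / (gamma (1 - p3 gamma^2)) matters, since for
   given gamma the least feasible K is (f(gamma) / (4 eps))^2. With t = p3 gamma^2, the critical
   points of f are the roots of (y - 1) t^2 + (y + 2) t = 1. At a critical point s the cubic
   p1 + p2 g^2 - f(s) g (1 - p3 g^2) in g has the double root s and an otherwise positive linear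
   factor, so s is the unique minimizer, without any calculus. *)
Require Import Defs.
From mathcomp Require Import all_boot all_order all_algebra.
From mathcomp Require Import reals.
From mathcomp Require Import ring lra.

Import Order.TTheory GRing.Theory Num.Theory.
Local Open Scope ring_scope.

Lemma norm2_sqr (R : realType) (n : nat) (v : 'cV[R]_n) :
  norm2 v ^+ 2 = \sum_(i < n) v i 0 ^+ 2.
Proof. by rewrite sqr_sqrtr // sumr_ge0 // => i _; rewrite sqr_ge0. Qed.

(** Since [m >= 1], the vector [1 + z] has a first entry, which is at least 1; this keeps [P1]
    positive even when [x1 = xstar]. *)
Lemma P1_gt0 (R : realType) (n m : nat) (x1 xstar : 'cV[R]_n)
    (zstar : 'cV[R]_m) :
  (0 < m)%N -> nonneg_vec zstar -> 0 < P1 x1 xstar zstar.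
Proof.
move=> m_gt0 z_ge0; apply: ltr_wpDl; first by rewrite mulr_ge0 ?sqr_ge0.
rewrite mulr_gt0 // norm2_sqr (bigD1 (Ordinal m_gt0)) //= ltr_wpDr //.
  by rewrite sumr_ge0 // => i _; rewrite sqr_ge0.
by rewrite !mxE exprn_gt0 // ltr_pwDl.
Qed.

Lemma P2_ge0 (R : realType) (m : nat) (CF sigmaF : R) (DG : 'cV[R]_m) :
  0 <= P2 CF sigmaF DG.
Proof.
by rewrite /P2 !(sqr_ge0, ler0n, addr_ge0, mulr_ge0).
Qed.

Definition stepsize_objective {R : fieldType} (p1 p2 p3 g : R) : R :=
  (p1 + p2 * g ^+ 2) / (g * (1 - p3 * g ^+ 2)).

(** The positive root of [(y - 1) t^2 + (y + 2) t = 1], with the numerator rationalized so that the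
    formula survives at [y = 1], where the equation becomes linear. *)
Definition normalized_stepsize {R : rcfType} (y : R) : R :=
  2 / (2 + y + Num.sqrt (y ^+ 2 + 8 * y)).

Lemma normalized_stepsizeP (R : rcfType) (y : R) : 1 <= y ->
  let t := normalized_stepsize y in
  [/\ 0 < t, t < 1 & (y - 1) * t ^+ 2 + (y + 2) * t = 1].
Proof.
move=> y_ge1; rewrite /normalized_stepsize /=; set r := Num.sqrt _.
have r_ge0 : 0 <= r by exact: sqrtr_ge0.
have r2 : r ^+ 2 = y ^+ 2 + 8 * y by rewrite sqr_sqrtr //; nra.
have d_gt0 : 0 < 2 + y + r by lra.
split; first by rewrite divr_gt0.
  by rewrite ltr_pdivrMr //; lra.
have -> : (y - 1) * (2 / (2 + y + r)) ^+ 2 + (y + 2) * (2 / (2 + y + r)) =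
  (4 * (y - 1) + 2 * (y + 2) * (2 + y + r)) / (2 + y + r) ^+ 2.
  by field; lra.
have -> : 4 * (y - 1) + 2 * (y + 2) * (2 + y + r) = (2 + y + r) ^+ 2.
  by lra.
by rewrite divff // expf_neq0 ?gt_eqF.
Qed.

Section StationaryStepsize.

Variables (R : realFieldType) (p1 p2 p3 s : R).
Hypotheses (p1_gt0 : 0 < p1) (p2_ge0 : 0 <= p2) (p3_gt0 : 0 < p3).
Hypotheses (s_gt0 : 0 < s) (s_lt : p3 * s ^+ 2 < 1).
(* f'(s) = 0 for f the objective, cleared of denominators. *)
Hypothesis stationary :
  p2 * p3 * s ^+ 4 + (p2 + 3 * p1 * p3) * s ^+ 2 = p1.

Local Notation f := (stepsize_objective p1 p2 p3).

Lemma stepsize_objective_gt0 g : 0 < g -> p3 * g ^+ 2 < 1 -> 0 < f g.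
Proof.
move=> g_gt0 g_lt; rewrite divr_gt0 ?mulr_gt0 ?subr_gt0 //.
by rewrite ltr_pwDl // mulr_ge0 ?sqr_ge0.
Qed.

(** The left side vanishes at [g = s] by definition of [f s], and its derivative vanishes there by
    stationarity. The leading coefficient [f s * p3] and the constant term [p1] then determine the
    linear cofactor. *)
Lemma stepsize_objective_double_root g :
  p1 + p2 * g ^+ 2 - f s * (g * (1 - p3 * g ^+ 2)) =
  (g - s) ^+ 2 * (f s * p3 * g + p1 / s ^+ 2).
Proof.
have s2_gt0 : 0 < s ^+ 2 by rewrite exprn_gt0.
have t_gt0 : 0 < p3 * s ^+ 2 by rewrite mulr_gt0.
(* Stationarity is linear in [p2]; eliminating [p2] turns the claim into a rational identity in free
   variables. *)
have p2E : p2 = p1 * (1 - 3 * (p3 * s ^+ 2)) / (s ^+ 2 * (1 + p3 * s ^+ 2)).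
  apply: (canRL (mulfK _)); first by rewrite gt_eqF // mulr_gt0 //; lra.
  have stat0 := subrr p1; rewrite -{1}stationary in stat0.
  by apply: subr0_eq; rewrite -[RHS]stat0; ring.
by rewrite /stepsize_objective p2E; field; rewrite !gt_eqF ?subr_gt0 ?addr_gt0.
Qed.

Lemma double_root_cofactor_gt0 g : 0 < g -> 0 < f s * p3 * g + p1 / s ^+ 2.
Proof.
move=> g_gt0; have fs_gt0 := stepsize_objective_gt0 _ s_gt0 s_lt.
rewrite addr_gt0 ?(divr_gt0 p1_gt0) ?exprn_gt0 //.
exact: mulr_gt0 (mulr_gt0 fs_gt0 p3_gt0) g_gt0.
Qed.

Lemma stepsize_objective_min g : 0 < g -> p3 * g ^+ 2 < 1 -> f s <= f g.
Proof.
move=> g_gt0 g_lt; rewrite {2}/stepsize_objective.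
rewrite ler_pdivlMr ?mulr_gt0 ?subr_gt0 // -subr_ge0.
rewrite stepsize_objective_double_root mulr_ge0 ?sqr_ge0 // ltW //.
exact: double_root_cofactor_gt0.
Qed.

(** If [f g <= f s], the cubic is nonpositive at [g]; its linear cofactor being positive,
    [(g - s)^2] must vanish. *)
Lemma stepsize_objective_argmin g :
  0 < g -> p3 * g ^+ 2 < 1 -> f g <= f s -> g = s.
Proof.
move=> g_gt0 g_lt; rewrite {1}/stepsize_objective.
rewrite ler_pdivrMr ?mulr_gt0 ?subr_gt0 // -subr_le0.
rewrite stepsize_objective_double_root.
rewrite pmulr_lle0 ?double_root_cofactor_gt0 // => le0.
apply/eqP; rewrite -subr_eq0 -sqrf_eq0.
by rewrite eq_le le0 sqr_ge0.
Qed.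

End StationaryStepsize.

(** This decouples the variables: for fixed [g], the constraint is just a lower bound on the square
    root of [K]. *)
Lemma feasibleP (R : realType) (p1 p2 p3 eps K g : R) :
  feasible p1 p2 p3 eps K g <->
  [/\ 0 < K, 0 < g, p3 * g ^+ 2 < 1 &
      stepsize_objective p1 p2 p3 g <= 4 * eps * Num.sqrt K].
Proof.
suff E : 0 < K -> 0 < g -> p3 * g ^+ 2 < 1 ->
    ((p1 + p2 * g ^+ 2) / (4 * g * Num.sqrt K * (1 - p3 * g ^+ 2)) <= eps) =
    (stepsize_objective p1 p2 p3 g <= 4 * eps * Num.sqrt K).
  by split=> [[K0 g0 le lt]|[K0 g0 lt le]]; split; rewrite // ?E // -E.
move=> K_gt0 g_gt0 g_lt.
have r_gt0 : 0 < Num.sqrt K by rewrite sqrtr_gt0.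
have d_gt0 : 0 < 1 - p3 * g ^+ 2 by rewrite subr_gt0.
have -> : (p1 + p2 * g ^+ 2) / (4 * g * Num.sqrt K * (1 - p3 * g ^+ 2)) =
    stepsize_objective p1 p2 p3 g / (4 * Num.sqrt K).
  by rewrite /stepsize_objective; field; rewrite !gt_eqF.
by rewrite ler_pdivrMr ?mulr_gt0 // mulrA [eps * 4]mulrC.
Qed.

Theorem proposition2p5 (R : realType) (n m : nat) (hm : (1 <= m)%N)
    (x1 xstar : 'cV[R]_n) (zstar : 'cV[R]_m) (hz : nonneg_vec zstar)
    (CF sigmaF : R) (hCF : 0 <= CF) (hsigmaF : 0 <= sigmaF)
    (CG DG sigmaG : 'cV[R]_m) (hCG : nonneg_vec CG) (hDG : nonneg_vec DG)
    (hsigmaG : nonneg_vec sigmaG)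
    (hP3 : 0 < P3 CG sigmaG) (eps : R) (heps : 0 < eps) :
  let p1 := P1 x1 xstar zstar in
  let p2 := P2 CF sigmaF DG in
  let p3 := P3 CG sigmaG in
  let y := 1 + p2 / (p1 * p3) in
  exists Kstar gammastar : R,
    [/\ optimal_solution p1 p2 p3 eps Kstar gammastar,
        forall K gamma : R, optimal_solution p1 p2 p3 eps K gamma ->
          K = Kstar /\ gamma = gammastar,
        gammastar ^+ 2 = 2 * p3^-1 / (2 + y + Num.sqrt (y ^+ 2 + 8 * y))
      & Kstar = (p1 + p2 * gammastar ^+ 2) ^+ 2
          / (16 * gammastar ^+ 2 * (1 - p3 * gammastar ^+ 2) ^+ 2 * eps ^+ 2)].
Proof.
move=> p1 p2 p3 y.
have p1_gt0 : 0 < p1 by exact: P1_gt0.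
have p2_ge0 : 0 <= p2 by exact: P2_ge0.
have p3_gt0 : 0 < p3 := hP3.
have y_ge1 : 1 <= y by rewrite lerDl divr_ge0 // mulr_ge0 // ltW.
have [t_gt0 t_lt1 tE] := normalized_stepsizeP _ _ y_ge1.
set t := normalized_stepsize y in t_gt0 t_lt1 tE.
pose s := Num.sqrt (t / p3).
have u_gt0 : 0 < t / p3 by rewrite divr_gt0.
have s_gt0 : 0 < s by rewrite sqrtr_gt0.
have s2 : s ^+ 2 = t / p3 by rewrite sqr_sqrtr // ltW.
have p3s2 : p3 * s ^+ 2 = t by rewrite s2 mulrC divfK // gt_eqF.
have s_lt : p3 * s ^+ 2 < 1 by rewrite p3s2.
(* This is [p1] times the quadratic equation for [t], because [p1 * (y - 1) = p2 / p3] and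
   [s^2 = t / p3]. *)
have stationary : p2 * p3 * s ^+ 4 + (p2 + 3 * p1 * p3) * s ^+ 2 = p1.
  rewrite -[4%N]/(2 * 2)%N exprM s2 -[RHS]mulr1 -[X in _ = _ * X]tE /y.
  by field; rewrite !gt_eqF.
pose M := stepsize_objective p1 p2 p3 s.
have M_gt0 : 0 < M by exact: stepsize_objective_gt0.
have M_min g : 0 < g -> p3 * g ^+ 2 < 1 -> M <= stepsize_objective p1 p2 p3 g.
  exact: stepsize_objective_min.
(* This value makes the constraint an equality at [s]. *)
pose K := (M / (4 * eps)) ^+ 2.
have q_gt0 : 0 < M / (4 * eps) by rewrite divr_gt0 // mulr_gt0.
have sqrtK : 4 * eps * Num.sqrt K = M.
  by rewrite sqrtr_sqr gtr0_norm // mulrC divfK // gt_eqF // mulr_gt0.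
have feasK : feasible p1 p2 p3 eps K s.
  by apply/feasibleP; split; rewrite ?sqrtK // exprn_gt0.
have optK : optimal_solution p1 p2 p3 eps K s.
  split=> // K' g /feasibleP[K'_gt0 g_gt0 g_lt le].
  rewrite -(ler_sqrt _ (ltW K'_gt0)) -(ler_pM2l (_ : 0 < 4 * eps)) ?mulr_gt0 //.
  by rewrite sqrtK (le_trans _ le) // M_min.
exists K, s; split=> //.
- move=> K' g [feas' min'].
  (* Two optimal solutions bound each other's [K]. Feasibility at this common [K] then forces the
     objective at [g] down to [M], which only [s] attains. *)
  have KE : K' = K.
    by apply/eqP; rewrite eq_le (min' _ _ feasK) (optK.2 _ _ feas').
  split=> //; move: feas'; rewrite KE => /feasibleP[_ g_gt0 g_lt].
  by rewrite sqrtK; apply: stepsize_objective_argmin.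
- by rewrite s2 /t /normalized_stepsize mulrAC.
- by rewrite /K /M /stepsize_objective; field; rewrite !gt_eqF // subr_gt0.
Qed.
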